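(* Let $\mathbb{F}$ be a finite field, let $\mathcal{C}\subseteq\mathbb{F}^n$ be a $k$-dimensional linear code with support $\mathcal{I}=\{0,\ldots,n-1\}$, let $G\in\mathbb{F}^{k\times n}$ be a generator matrix and $H\in\mathbb{F}^{(n-k)\times n}$ a parity check matrix of $\mathcal{C}$, and let $\mathcal{S}=[(a_l,b_l],\,l=1,\ldots,k]$ be any span list for $G$. Then the BCJR-trellis $T_{(G,H,\mathcal{S})}$ is non-mergeable.
   Context: Trellises. A (tail-biting) trellis $T=(V,E)$ of depth $n$ over $\mathbb{F}$ has a vertex set that is the disjoint union $V=V_0\cup\ldots\cup V_{n-1}$ and edge sets $E_i\subseteq V_i\times\mathbb{F}\times V_{i+1}$ for $i\in\mathcal{I}=\{0,\ldots,n-1\}$ (time indices are always taken modulo $n$); $(v,a,w)\in E_i$ is an edge from $v$ to $w$ with label $a$. A cycle is a closed path of length $n$ starting and ending at the same vertex of $V_0$. The edge-label code $\mathcal{C}(T)\subseteq\mathbb{F}^n$ is the set of label sequences $(c_0,\ldots,c_{n-1})$ of all cycles of $T$; $T$ represents $\mathcal{C}$ if $\mathcal{C}(T)=\mathcal{C}$. Non-mergeable. A trellis $T$ representing $\mathcal{C}$ is non-mergeable if for every $i\in\mathcal{I}$ and any two distinct vertices $v_1,v_2\in V_i$, merging them yields a trellis that does not represent $\mathcal{C}$. Merging means replacing $v_1,v_2$ by a single vertex $\hat v$ at time $i$, replacing each edge $(v_j,a,w)\in E_i$ by $(\hat v,a,w)$ and each edge $(w,a,v_j)\in E_{i-1}$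 by $(w,a,\hat v)$, $j=1,2$. Spans. For $a,b\in\mathcal{I}$ put $[a,b]=\{a,a+1,\ldots,b\}$ if $a\le b$ and $[a,b]=\{a,\ldots,n-1,0,\ldots,b\}$ if $a>b$, and $(a,b]=[a,b]\setminus\{a\}$. The interval $(a,b]$ is a span of a nonzero vector $c=(c_0,\ldots,c_{n-1})\in\mathbb{F}^n$ if $c_a\ne0\ne c_b$ and $c_j=0$ for $j\notin[a,b]$ (intervals are recorded by their endpoints $a,b$). A span list for $G$ is a list $\mathcal{S}=[(a_l,b_l],\,l=1,\ldots,k]$ where $(a_l,b_l]$ is a span of the $l$-th row of $G$. BCJR-trellis. Let $G=(g_{lj})$ have columns $G_0,\ldots,G_{n-1}\in\mathbb{F}^{k}$ and let $H_0,\ldots,H_{n-1}\in\mathbb{F}^{n-k}$ be the rows of $H^{\sf T}$, where $\mathcal{C}=\{\alpha G\mid\alpha\in\mathbb{F}^k\}=\{c\in\mathbb{F}^n\mid cH^{\sf T}=0\}$. Let $D\in\mathbb{F}^{k\times(n-k)}$ be the matrix with rows $d_l=\sum_{j=a_l}^{n-1}g_{lj}H_j$, $l=1,\ldots,k$. Put $N_0=D$ and $N_i=N_{i-1}+G_{i-1}H_{i-1}$ for $i=1,\ldots,n$ (here $G_{i-1}H_{i-1}$ is the $k\times(n-k)$ product column times row); then $N_n=N_0$. The BCJR-trellis $T_{(G,H,\mathcal{S})}$ has vertex spaces $V_i=\{\alpha N_i\mid\alpha\in\mathbb{F}^k\}$ and edge spaces $E_i=\{(\alpha N_i,\alpha G_i,\alpha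 N_{i+1})\mid\alpha\in\mathbb{F}^k\}$, $i\in\mathcal{I}$. It is known that it represents $\mathcal{C}$. *)

(* Defs.v *)
From HB Require Import structures.
From mathcomp Require Import all_boot all_order all_algebra.

Set Implicit Arguments.
Unset Strict Implicit.
Unset Printing Implicit Defensive.

Import GRing.Theory.
Local Open Scope ring_scope.

(* The vertex sets share a carrier [U] but are kept disjoint by the time index:
   a vertex is a pair of a time i and an element of [vertices T i].
   [ordS] is the successor modulo n, so the last edge set leads back to time 0. *)
Record trellis (F U : finType) (n : nat) := Trellis {
  vertices : 'I_n -> {set U};
  edges : 'I_n -> {set U * F * U};
  edges_sub : forall i u a w, (u, a, w) \in edges i ->
    u \in vertices i /\ w \in vertices (ordS i)
}.

(* [p i] is the vertex visited at time i; the edge at time n-1 ends in [p 0]. *)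
Definition is_cycle (F U : finType) (n : nat) (T : trellis F U n)
    (p : {ffun 'I_n -> U}) (c : 'rV[F]_n) : bool :=
  [forall i, (p i, c 0 i, p (ordS i)) \in edges T i].

Definition edge_label_code (F U : finType) (n : nat) (T : trellis F U n) :
    {set 'rV[F]_n} :=
  [set c | [exists p, is_cycle T p c]].

Definition represents (F : finFieldType) (U : finType) (n : nat)
    (T : trellis F U n) (C : {vspace 'rV[F]_n}) : Prop :=
  edge_label_code T =i C.

Section Merge.
Variables (F U : finType) (n : nat) (T : trellis F U n).
Variables (i : 'I_n) (v1 v2 : U).

(* [None] is the new vertex at time i; [Some v] is the old vertex v. *)
Definition merge_vertex (j : 'I_n) (v : U) : option U :=
  if (j == i) && ((v == v1) || (v == v2)) then None else Some v.

Definition merge_vertices (j : 'I_n) : {set option U} :=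
  [set merge_vertex j v | v in vertices T j].

Definition merge_edges (j : 'I_n) : {set option U * F * option U} :=
  [set (merge_vertex j e.1.1, e.1.2, merge_vertex (ordS j) e.2)
    | e in edges T j].

Lemma merge_edges_sub j u a w : (u, a, w) \in merge_edges j ->
  u \in merge_vertices j /\ w \in merge_vertices (ordS j).
Proof.
case/imsetP=> -[[u' a'] w'] /edges_sub[u'V w'V] [-> _ ->].
by split; apply: imset_f.
Qed.

Definition merge : trellis F (option U) n := Trellis merge_edges_sub.

End Merge.

Definition non_mergeable (F : finFieldType) (U : finType) (n : nat)
    (T : trellis F U n) (C : {vspace 'rV[F]_n}) : Prop :=
  represents T C /\
  forall (i : 'I_n) (v1 v2 : U),
    v1 \in vertices T i -> v2 \in vertices T i -> v1 != v2 ->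
    ~ represents (merge T i v1 v2) C.

Definition full_support (F : finFieldType) (n : nat)
    (C : {vspace 'rV[F]_n}) : Prop :=
  forall i : 'I_n, exists2 c : 'rV[F]_n, c \in C & c 0 i != 0.

Definition generator_matrix (F : finFieldType) (n k : nat)
    (C : {vspace 'rV[F]_n}) (G : 'M[F]_(k, n)) : Prop :=
  forall c : 'rV[F]_n, c \in C <-> exists alpha : 'rV[F]_k, c = alpha *m G.

Definition parity_check_matrix (F : finFieldType) (n r : nat)
    (C : {vspace 'rV[F]_n}) (H : 'M[F]_(r, n)) : Prop :=
  forall c : 'rV[F]_n, c \in C <-> c *m H^T = 0.

(* j \in [a, b], the interval wrapping around when b < a. *)
Definition in_cyclic_interval (n : nat) (a b j : 'I_n) : bool :=
  if (a <= b)%N then (a <= j <= b)%N else (a <= j)%N || (j <= b)%N.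

(* The span (a, b] is recorded by the pair (a, b). *)
Definition is_span (F : finFieldType) (n : nat) (s : 'I_n * 'I_n)
    (c : 'rV[F]_n) : Prop :=
  [/\ c 0 s.1 != 0, c 0 s.2 != 0 &
      forall j : 'I_n, ~~ in_cyclic_interval s.1 s.2 j -> c 0 j = 0].

Definition is_span_list (F : finFieldType) (n k : nat)
    (S : k.-tuple ('I_n * 'I_n)) (G : 'M[F]_(k, n)) : Prop :=
  forall l : 'I_k, is_span (tnth S l) (row l G).

Section BCJR.
Variables (F : finFieldType) (n k r : nat).
Variables (G : 'M[F]_(k, n)) (H : 'M[F]_(r, n)) (S : k.-tuple ('I_n * 'I_n)).

Definition bcjr_D : 'M[F]_(k, r) :=
  \matrix_(l < k) \sum_(j < n | ((tnth S l).1 <= j)%N) G l j *: row j H^T.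

(* Only the values N_0, ..., N_n are meaningful; the sequence is constant
   afterwards. *)
Fixpoint bcjr_N (i : nat) : 'M[F]_(k, r) :=
  if i is i'.+1 then
    bcjr_N i' +
      (if insub i' is Some j then col (j : 'I_n) G *m row j H^T else 0)
  else bcjr_D.

Definition bcjr_vertices (i : 'I_n) : {set 'rV[F]_r} :=
  [set alpha *m bcjr_N i | alpha : 'rV[F]_k].

Definition bcjr_edges (i : 'I_n) : {set 'rV[F]_r * F * 'rV[F]_r} :=
  [set (alpha *m bcjr_N i, (alpha *m col i G) 0 0, alpha *m bcjr_N (ordS i))
    | alpha : 'rV[F]_k].

Lemma bcjr_edges_sub i u a w : (u, a, w) \in bcjr_edges i ->
  u \in bcjr_vertices i /\ w \in bcjr_vertices (ordS i).
Proof. by case/imsetP=> alpha _ [-> _ ->]; split; apply: imset_f. Qed.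

Definition bcjr_trellis : trellis F 'rV[F]_r n := Trellis bcjr_edges_sub.

End BCJR.

(* Main.v *)
(* An edge (u, a, w) at time j satisfies w = u + a H_j.  Summing this around a
   closed path shows that the labels of a cycle form a codeword.  Merging v1
   and v2 at time i creates closed paths that leave time i from v2 and return
   to v1; the same sum gives c H^T = v1 - v2 <> 0, so the label sequence c of
   such a path is not a codeword.  A path of this kind always exists: write
   v1 = alpha1 N_i and v2 = alpha2 N_i, start with the coefficient vector
   alpha2, and replace its l-th entry by that of alpha1 at time a_l.  This does
   not change the current vertex because row l of N_(a_l) vanishes. *)
Require Import Defs.
From mathcomp Require Import all_boot all_order all_algebra zify.

Set Implicit Arguments.
Unset Strict Implicit.
Unset Printing Implicit Defensive.

Import GRing.Theory.
Local Open Scope ring_scope.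

Lemma ordS_val n (j : 'I_n) :
  nat_of_ord (ordS j) = if (j.+1 < n)%N then j.+1 else 0%N.
Proof.
case: ifP => [lt_j1n | ge_j1n] /=; first exact: modn_small.
by have -> : j.+1 = n; [have := ltn_ord j; lia | exact: modnn].
Qed.

Lemma in_cyclic_interval_id n (i a : 'I_n) :
  in_cyclic_interval i i a = (a == i).
Proof. by rewrite /in_cyclic_interval leqnn -val_eqE /=; lia. Qed.

Lemma in_cyclic_interval_full n (i j a : 'I_n) :
  ordS j = i -> in_cyclic_interval i j a.
Proof.
move=> <-; rewrite /in_cyclic_interval ordS_val.
by have := ltn_ord a; case: ifP; case: ifP; lia.
Qed.

(** Moving the right end one step adds only the point [ordS j]. The case [ordS j = i] is excluded
    because there the interval drops from everything to the single point i. *)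
Lemma in_cyclic_interval_ordS n (i j a : 'I_n) :
  ordS j != i -> a != ordS j ->
  in_cyclic_interval i (ordS j) a = in_cyclic_interval i j a.
Proof.
rewrite -!(inj_eq (@ord_inj n)) /in_cyclic_interval !ordS_val.
by have := ltn_ord a; have := ltn_ord i; do !case: ifP; lia.
Qed.

Lemma eq_mulmx_rows (R : pzRingType) k r (x y : 'rV[R]_k) (N : 'M[R]_(k, r)) :
  (forall l, row l N = 0 \/ x 0 l = y 0 l) -> x *m N = y *m N.
Proof.
move=> eqxy; apply/rowP=> t; rewrite !mxE; apply: eq_bigr => l _.
by case: (eqxy l) => [/rowP/(_ t) | ->] //; rewrite !mxE => ->; rewrite !mulr0.
Qed.

Lemma sum_ordS (V : zmodType) n (f : 'I_n -> V) :
  \sum_j f (ordS j) = \sum_j f j.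
Proof. by rewrite [RHS](reindex_inj (@ordS_inj n)). Qed.

Lemma generator_parity_mul0 (F : finFieldType) n k r (C : {vspace 'rV[F]_n})
    (G : 'M[F]_(k, n)) (H : 'M[F]_(r, n)) :
  generator_matrix C G -> parity_check_matrix C H -> G *m H^T = 0.
Proof.
move=> genG parH; apply/row_matrixP=> l; rewrite row0 row_mul.
by apply/parH/genG; exists (delta_mx 0 l); rewrite -rowE.
Qed.

Section BCJRTrellis.
Variables (F : finFieldType) (n k r : nat).
Variables (G : 'M[F]_(k, n)) (H : 'M[F]_(r, n)) (S : k.-tuple ('I_n * 'I_n)).
Hypothesis GH0 : G *m H^T = 0.

Local Notation N := (bcjr_N G H S).

Lemma row_bcjr_N m l : row l (N m) =
  \sum_(j < n | ((tnth S l).1 <= j)%N) G l j *: row j H^T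
    + \sum_(j < n | (j < m)%N) G l j *: row j H^T.
Proof.
elim: m => [|m IHm] /=; first by rewrite rowK [X in _ + X]big_pred0 ?addr0.
rewrite linearD /= {}IHm -addrA; congr (_ + _).
(* For m >= n nothing is added, and both [j < m] and [j < m.+1] hold for every j. *)
case: insubP => [j _ jm | ge_mn]; last first.
  rewrite linear0 addr0; apply: eq_bigl => j.
  by rewrite -leqNgt in ge_mn; have := ltn_ord j; lia.
rewrite [RHS](bigD1 j) /= ?jm // addrC; congr (_ + _).
  by apply/rowP=> t; rewrite !mxE big_ord1 !mxE.
by apply: eq_bigl => i; rewrite -(inj_eq val_inj) /= jm; lia.
Qed.

Lemma sum_row_parity l : \sum_j G l j *: row j H^T = 0.
Proof.
transitivity (row l (G *m H^T)); last by rewrite GH0 row0.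
by rewrite row_mul mulmx_sum_row; apply: eq_bigr => j _; rewrite mxE.
Qed.

(** At time a_l the two sums in [row_bcjr_N] run over j >= a_l and j < a_l, so together they give
    row l of [G *m H^T]. *)
Lemma row_bcjr_N_start l : row l (N (tnth S l).1) = 0.
Proof.
rewrite row_bcjr_N -[RHS](sum_row_parity l).
rewrite [RHS](bigID (fun j : 'I_n => (tnth S l).1 <= j)%N) /=.
by congr (_ + _); apply: eq_bigl => j; rewrite ltnNge.
Qed.

Lemma bcjr_N_period : N n = N 0.
Proof.
apply/row_matrixP=> l; rewrite !row_bcjr_N; congr (_ + _).
rewrite [RHS]big_pred0 // -[RHS](sum_row_parity l).
by apply: eq_bigl => j; rewrite ltn_ord.
Qed.

Lemma bcjr_N_ordS (j : 'I_n) : N (ordS j) = N j + col j G *m row j H^T.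
Proof.
(* At j = n-1 the successor is 0, and periodicity closes the gap. *)
have -> : N (ordS j) = N j.+1.
  rewrite ordS_val; case: ifP => // ge_j1n.
  by rewrite -bcjr_N_period; congr N; have := ltn_ord j; lia.
by rewrite /= valK.
Qed.

Lemma mul_bcjr_N_ordS (x : 'rV[F]_k) (j : 'I_n) :
  x *m N (ordS j) = x *m N j + (x *m col j G) 0 0 *: row j H^T.
Proof.
rewrite bcjr_N_ordS mulmxDr mulmxA; congr (_ + _).
by rewrite {1}[x *m col j G]mx11_scalar mul_scalar_mx.
Qed.

Lemma bcjr_cycle_parity p (c : 'rV[F]_n) :
  is_cycle (bcjr_trellis G H S) p c -> c *m H^T = 0.
Proof.
move/forallP=> cyc; rewrite mulmx_sum_row.
transitivity (\sum_j (p (ordS j) - p j)); last first.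
  by rewrite sumrB sum_ordS subrr.
apply: eq_bigr => j _; have /imsetP[x _ [-> -> ->]] := cyc j.
by rewrite mul_bcjr_N_ordS addrC addKr.
Qed.

Lemma bcjr_represents (C : {vspace 'rV[F]_n}) :
  generator_matrix C G -> parity_check_matrix C H ->
  represents (bcjr_trellis G H S) C.
Proof.
move=> genG parH c; rewrite inE; apply/existsP/idP => [[p cyc] | /genG[x ->]].
  exact/parH/(bcjr_cycle_parity cyc).
(* The codeword [x *m G] is read off the cycle whose coefficient vector is constantly x. *)
exists [ffun j : 'I_n => x *m N j]; apply/forallP=> j; rewrite !ffunE.
apply/imsetP; exists x => //; congr (_, _, _); rewrite !mxE.
by apply: eq_bigr => l _; rewrite mxE.
Qed.

Lemma merge_label_not_parity (i : 'I_n) v1 v2 :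
  v1 \in bcjr_vertices G H S i -> v2 \in bcjr_vertices G H S i ->
  exists2 c, c \in edge_label_code (Defs.merge (bcjr_trellis G H S) i v1 v2)
           & c *m H^T = v1 - v2.
Proof.
case/imsetP=> x1 _ v1E /imsetP[x2 _ v2E].
(* [A j] is the coefficient vector of the edge used at time j: the entries already switched to [x1]
   are those with a_l in [i, j]. *)
pose A (j : 'I_n) : 'rV[F]_k :=
  \row_l if in_cyclic_interval i j (tnth S l).1 then x1 0 l else x2 0 l.
have A_start : A i *m N i = v2.
  rewrite v2E; apply: eq_mulmx_rows => l; rewrite mxE in_cyclic_interval_id.
  by case: eqP => [<- | _]; [left; apply: row_bcjr_N_start | right].
have A_end j : ordS j = i -> A j *m N (ordS j) = v1.
  move=> ji; rewrite v1E ji; congr (_ *m _); apply/rowP=> l.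
  by rewrite mxE in_cyclic_interval_full.
have A_step j : ordS j != i -> A j *m N (ordS j) = A (ordS j) *m N (ordS j).
  move=> ji; apply: eq_mulmx_rows => l; rewrite !mxE.
  have [<- | la] := eqVneq (tnth S l).1 (ordS j).
    by left; apply: row_bcjr_N_start.
  by right; rewrite in_cyclic_interval_ordS.
(* Consecutive edges meet after merging: at time i the arrival v1 and the departure v2 both become
   [None]. *)
have merge_A j : merge_vertex i v1 v2 (ordS j) (A (ordS j) *m N (ordS j)) =
    merge_vertex i v1 v2 (ordS j) (A j *m N (ordS j)).
  have [ji | /A_step-> //] := eqVneq (ordS j) i.
  by rewrite (A_end _ ji) ji A_start /merge_vertex !eqxx orbT.
exists (\row_j (A j *m col j G) 0 0).
  rewrite inE; apply/existsP.
  exists [ffun j => merge_vertex i v1 v2 j (A j *m N j)].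
  apply/forallP=> j; rewrite !ffunE; apply/imsetP.
  exists (A j *m N j, (A j *m col j G) 0 0, A j *m N (ordS j)).
    by apply/imsetP; exists (A j).
  rewrite [X in (_, X, _)]mxE; congr (_, _, _).
  exact: merge_A.
rewrite mulmx_sum_row.
(* Shifting the sum of the start vertices by one step makes each term compare arrival and departure
   at time [ordS j]; they differ at most at time i. *)
transitivity (\sum_j (A j *m N (ordS j) - A (ordS j) *m N (ordS j))).
  rewrite sumrB (sum_ordS (fun j => A j *m N j)) -sumrB; apply: eq_bigr => j _.
  by rewrite mul_bcjr_N_ordS mxE addrC addKr.
rewrite (bigD1 (ord_pred i)) // big1 => [|j ji].
  by rewrite (A_end _ (ord_predK i)) ord_predK A_start /= addr0.
by rewrite A_step ?subrr // (can2_eq (@ordSK n) (@ord_predK n)).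
Qed.

End BCJRTrellis.

Theorem corollary4p9 (F : finFieldType) (n k : nat)
    (C : {vspace 'rV[F]_n})
    (G : 'M[F]_(k, n)) (H : 'M[F]_(n - k, n))
    (S : k.-tuple ('I_n * 'I_n))
    (dimC : \dim C = k)
    (suppC : full_support C)
    (genG : generator_matrix C G)
    (parH : parity_check_matrix C H)
    (spanS : is_span_list S G) :
  non_mergeable (bcjr_trellis G H S) C.
Proof.
have GH0 := generator_parity_mul0 genG parH.
split; first exact: bcjr_represents.
move=> i v1 v2 v1V v2V /negP neq_v reprC; apply: neq_v.
have [c cM cH] := merge_label_not_parity GH0 v1V v2V.
by rewrite -subr_eq0 -cH; apply/eqP/parH; rewrite -reprC.
Qed.
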